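(* Let $\mathcal{X}$ be a Banach space, let $F:\mathcal{X}\to\mathbb{R}$ be a functional, let $\mathcal{V}\subseteq\mathcal{X}$ be a subspace, let $x\in\mathcal{X}$ and consider the corresponding coset $\mathcal{W}:=x+\mathcal{V}$. Assume that $F$ is Fréchet-differentiable at $w_c\in\mathcal{W}$. Then $w_c$ is a critical point of $F$ over $\mathcal{W}$ if and only if the Fréchet differential $DF_{w_c}$ belongs to the annihilator of $\mathcal{V}$.
   Context: The directional (Gâteaux) derivative of $F$ at $x_0$ in direction $v$ is $F'(x_0;v):=\lim_{\epsilon\to 0}\frac{F(x_0+\epsilon v)-F(x_0)}{\epsilon}$ ($\epsilon$ real) when the limit exists. $F$ is Fréchet-differentiable at $x_0$ if there exists a bounded linear functional $DF_{x_0}$ on $\mathcal{X}$ (the Fréchet differential) such that $\lim_{\|x\|_{\mathcal{X}}\to 0}\frac{|F(x_0+x)-F(x_0)-DF_{x_0}(x)|}{\|x\|_{\mathcal{X}}}=0$. A point $w_c\in\mathcal{W}$ is a critical point of $F$ over $\mathcal{W}=x+\mathcal{V}$ if $F'(w_c;v)=0$ for all $v\in\mathcal{V}$. The annihilator of $\mathcal{V}$ is the set of bounded linear functionals on $\mathcal{X}$ that vanish on $\mathcal{V}$. *)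

(* Defs.v *)
From mathcomp Require Import all_boot all_order all_algebra.
From mathcomp Require Import all_classical all_reals all_analysis.

Set Implicit Arguments.
Unset Strict Implicit.
Unset Printing Implicit Defensive.
Import GRing.Theory Num.Theory numFieldNormedType.Exports.

Local Open Scope classical_set_scope.
Local Open Scope ring_scope.

(* Cosets x + V of a linear subspace V, which need not be closed. *)
Definition coset_at (R : realType) (X : completeNormedModType R)
    (x : X) (V : submodClosed X) : set X :=
  [set x + v | v in [set` V]].

(* [is_derive w v F 0] asserts both that the limit defining the derivative of F
   at w along v exists and that it is 0. *)
Definition critical_point (R : realType) (X : completeNormedModType R)
    (F : X -> R) (x : X) (V : submodClosed X) (w : X) : Prop :=
  coset_at x V w /\ forall v : X, v \in V -> is_derive w v F 0.

Definition bounded_functional (R : realType) (X : completeNormedModType R)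
    (f : {linear X -> R}) : Prop :=
  exists M : R, forall y : X, `|f y| <= M * `|y|.

Definition annihilator (R : realType) (X : completeNormedModType R)
    (V : submodClosed X) : set {linear X -> R} :=
  [set f | bounded_functional f /\ forall v : X, v \in V -> f v = 0].

(* Main.v *)
Require Import Defs.
From mathcomp Require Import all_boot all_order all_algebra.
From mathcomp Require Import all_classical all_reals all_analysis.
Import GRing.Theory Num.Theory numFieldNormedType.Exports.
Local Open Scope classical_set_scope.
Local Open Scope ring_scope.

(** Fréchet differentiability makes the derivative along every [v] exist and equal ['d F w_c v]
    ([deriveE]), so one vanishes on [V] exactly when the other does. Boundedness of the differential
    comes from its continuity, via [linear_boundedP]. *)

Theorem theorem9p1 (R : realType) (X : completeNormedModType R)
  (F : X -> R) (V : submodClosed X) (x w_c : X)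
  (hw : coset_at x V w_c) (hF : differentiable F w_c) :
  critical_point F x V w_c <-> annihilator V ('d F w_c).
Proof.
split=> [[_ Fw0]|[_ dF0]].
  split.
    have /linear_bounded_continuous/linear_boundedP [M [_ dFM]] :=
      diff_continuous hF.
    (* [dFM] bounds the differential only with constants strictly above [M]. *)
    by exists (M + 1); apply: dFM; rewrite ltrDl.
  by move=> v /Fw0 dFv; rewrite -deriveE// derive_val.
split=> // v vV; apply: DeriveDef; first exact: diff_derivable.
by rewrite deriveE// dF0.
Qed.
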